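(* If $G$ is an almost bipartite non-König-Egerváry graph, then $$|\mathrm{corona}(G)|+|\mathrm{core}(G)|=2\alpha(G)+1.$$
   Context: All graphs are finite, undirected, without loops or multiple edges. $\alpha(G)$ is the maximum size of an independent set, $\mu(G)$ the maximum size of a matching, $n(G)=|V(G)|$. $G$ is a König-Egerváry graph if $\alpha(G)+\mu(G)=n(G)$, and non-König-Egerváry otherwise. A cycle is a closed trail whose only repeated vertices are the first and the last. $G$ is almost bipartite if it has a unique odd cycle. $\mathrm{core}(G)$ is the intersection, and $\mathrm{corona}(G)$ the union, of all maximum independent sets of $G$. *)

(* Defs.v *)
From mathcomp Require Import all_boot.

Set Implicit Arguments.
Unset Strict Implicit.
Unset Printing Implicit Defensive.

(* A finite simple graph is a symmetric irreflexive relation e on a finType T;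
   an edge is the two-element set of its endpoints. *)
Section Graph.

Variables (T : finType) (e : rel T).

Definition edges : {set {set T}} := [set [set x; y] | x in T, y in T & e x y].

Definition independent (S : {set T}) : bool :=
  [forall x in S, forall y in S, ~~ e x y].

Definition alpha : nat := \max_(S : {set T} | independent S) #|S|.

Definition matching (M : {set {set T}}) : bool :=
  (M \subset edges) && trivIset M.

Definition mu : nat := \max_(M : {set {set T}} | matching M) #|M|.

Definition konig_egervary : Prop := alpha + mu = #|T|.

Definition max_independent (S : {set T}) : bool :=
  independent S && (#|S| == alpha).

Definition core : {set T} := \bigcap_(S : {set T} | max_independent S) S.

Definition corona : {set T} := \bigcup_(S : {set T} | max_independent S) S.

Definition cycle_edges (c : seq T) : {set {set T}} :=
  [set [set x; next c x] | x in c].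

(* A cycle is identified with its edge set, so that rotating or reversing the
   sequence of its vertices gives the same cycle; the bound 2 < size c expresses
   that the closed walk repeats no edge. *)
Definition odd_cycle (C : {set {set T}}) : Prop :=
  exists c : seq T,
    [/\ cycle e c, uniq c, 2 < size c, odd (size c) & C = cycle_edges c].

Definition almost_bipartite : Prop := exists! C : {set {set T}}, odd_cycle C.

End Graph.

(* Main.v *)
(* Call (P, Q) a pair when no edge joins P to Q; P and Q may overlap. In a
   bipartite graph, splitting along the colours turns a pair into two
   independent sets of total size |P| + |Q|, so its weight |P| + |Q| is at most
   2 alpha.  If the edges xy and yz are alpha-critical, i.e. deleting them
   creates independent sets I and J of size greater than alpha, then
   (I :&: J :\ y, I :|: J) is a pair of weight greater than 2 alpha.
   Consequently an edge-minimal bipartite counterexample to Konig's theorem has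
   maximum degree at most 1, where the theorem is clear.
   Now let c be the odd cycle of G.  Deleting an edge of c leaves a bipartite
   graph, so Konig's theorem and alpha + mu < n make every edge of c critical
   and G has a pair of weight greater than 2 alpha.  Choose such a pair (P, Q)
   with |P| maximal.  As G - v is bipartite for v in c, colour splitting shows
   that weights are at most 2 alpha + 1, that c lies in P :\: Q, and that
   P :\ v is covered by maximum independent sets; hence P \subset corona, and
   Q \subset core by maximality of |P|.  Finally (corona, core) is itself a pair,
   so its weight is also at most 2 alpha + 1. *)

Require Import Defs.
From mathcomp Require Import all_boot zify.

Set Implicit Arguments.
Unset Strict Implicit.
Unset Printing Implicit Defensive.

Section Graph.

Context {T : finType}.
Implicit Types (e : rel T) (f : T -> bool) (P Q S I J : {set T}) (x y z : T).

(** * Edge deletion and nonadjacent pairs *)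

(** Comparing two-element sets deletes both orientations of the edge, so symmetry survives. *)
Definition remove_edge e x y : rel T :=
  fun a b => e a b && ([set a; b] != [set x; y]).

(** Measure for the inductions that delete an edge; an edge counts once per orientation. *)
Definition arc_count e := #|[set p : T * T | e p.1 p.2]|.

Definition bipartition e f := forall a b, e a b -> f a != f b.

Definition nonadjacent e P Q := [forall a in P, forall b in Q, ~~ e a b].

Lemma nonadjacentP e P Q :
  reflect (forall a b, a \in P -> b \in Q -> ~~ e a b) (nonadjacent e P Q).
Proof.
apply: (iffP forall_inP) => [H a b aP bQ | H a aP].
  exact: (forall_inP (H a aP)).
by apply/forall_inP => b; apply: H.
Qed.

Lemma remove_edge_sym e x y : symmetric e -> symmetric (remove_edge e x y).
Proof. by move=> e_sym a b; rewrite /remove_edge e_sym setUC. Qed.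

Lemma remove_edge_irr e x y : irreflexive e -> irreflexive (remove_edge e x y).
Proof. by move=> e_irr a; rewrite /remove_edge e_irr. Qed.

Lemma remove_edge_sub e x y : subrel (remove_edge e x y) e.
Proof. by move=> a b /andP[]. Qed.

Lemma remove_edgeP e x y a b : e a b ->
  [\/ remove_edge e x y a b, a = x /\ b = y | a = y /\ b = x].
Proof.
rewrite /remove_edge => -> /=; case: eqP => [E|_]; last by constructor 1.
have: b \in [set x; y] by rewrite -E set22.
have: a \in [set x; y] by rewrite -E set21.
have: y \in [set a; b] by rewrite E set22.
have: x \in [set a; b] by rewrite E set21.
by do 4!move/set2P=> [?|?]; subst; by [constructor 2 | constructor 3].
Qed.

Lemma arc_count_remove e x y : e x y ->
  arc_count (remove_edge e x y) < arc_count e.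
Proof.
move=> exy; apply/proper_card/properP; split.
  by apply/subsetP => p; rewrite !inE => /remove_edge_sub.
by exists (x, y); rewrite inE //= /remove_edge eqxx andbF.
Qed.

(** * Independence and matching numbers *)

Lemma leq_alpha e S : nonadjacent e S S -> #|S| <= alpha e.
Proof. exact: (@leq_bigmax_cond _ (independent e) (fun S => #|S|)). Qed.

Lemma alpha_attained e : exists2 S, nonadjacent e S S & #|S| = alpha e.
Proof.
have [|S iS E] :=
  @eq_bigmax_cond _ [pred S : {set T} | independent e S] (fun S => #|S|).
  by apply/card_gt0P; exists set0; apply/nonadjacentP => a b; rewrite inE.
by exists S; rewrite // -E; apply: eq_bigl.
Qed.

Lemma max_independentE e S :
  max_independent e S = nonadjacent e S S && (alpha e <= #|S|).
Proof.
rewrite /max_independent /independent -/(nonadjacent e S S).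
by case iS: (nonadjacent e S S) => //=; rewrite eqn_leq leq_alpha.
Qed.

Lemma leq_mu e M : matching e M -> #|M| <= mu e.
Proof. exact: (@leq_bigmax_cond _ (matching e) (fun M => #|M|)). Qed.

Lemma mu_attained e : exists2 M, matching e M & #|M| = mu e.
Proof.
have [|M mM E] :=
  @eq_bigmax_cond _ [pred M | matching e M] (fun M : {set {set T}} => #|M|).
  apply/card_gt0P; exists set0; rewrite inE /matching sub0set.
  by rewrite /trivIset /cover !big_set0 cards0.
by exists M; rewrite // -E; apply: eq_bigl.
Qed.

Lemma edgesP e A : reflect (exists x y, e x y /\ A = [set x; y]) (A \in edges e).
Proof.
apply: (iffP imset2P) => [[x y _] | [x [y [exy ->]]]].
  by rewrite inE => /andP[_ exy] ->; exists x, y.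
by exists x y; rewrite ?inE.
Qed.

Lemma leq_mu_sub e e' : subrel e e' -> mu e <= mu e'.
Proof.
move=> sub; have [M /andP[ME tM] <-] := mu_attained e; apply: leq_mu.
rewrite /matching tM andbT; apply/subsetP => A.
move=> /(subsetP ME) /edgesP[x [y [exy ->]]].
by apply/edgesP; exists x, y; split=> //; apply: sub.
Qed.

(** Every matching edge has an endpoint outside a given independent set, and disjoint edges give
    distinct endpoints. *)
Lemma alpha_mu_leq e : alpha e + mu e <= #|T|.
Proof.
have [S /nonadjacentP iS <-] := alpha_attained e.
have [M /andP[/subsetP ME tM] <-] := mu_attained e.
rewrite -(cardsC S) leq_add2l -sum1_card.
apply: (@leq_trans (\sum_(A in M) \sum_(x in A) (x \notin S))).
  apply: leq_sum => A /ME /edgesP[x [y [exy ->]]].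
  have [xS | xS] := boolP (x \in S).
    have yS : y \notin S by apply/negP => yS; move: (iS x y xS yS); rewrite exy.
    by rewrite (bigD1 y) ?set22 //= yS.
  by rewrite (bigD1 x) ?set21 //= xS.
rewrite -big_trivIset // -[leqRHS]sum1_card.
rewrite [leqRHS]big_mkcond [leqLHS]big_mkcond /=; apply: leq_sum => x _.
by rewrite inE; case: (x \in S); case: ifP.
Qed.

(** * Splitting a pair along a colouring *)

Definition color_swap f P Q := [set x | x \in if f x then P else Q].

(** An edge inside the new set would have ends of different colours, hence join [P] to [Q]. The
    colouring need only be proper on [P :|: Q], so the graph itself may contain odd cycles. *)
Lemma color_swap_nonadjacent e f P Q : symmetric e -> nonadjacent e P Q ->
    {in P :|: Q &, forall a b, e a b -> f a != f b} ->
  nonadjacent e (color_swap f P Q) (color_swap f P Q).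
Proof.
move=> e_sym /nonadjacentP PQ fPQ; apply/nonadjacentP => a b.
rewrite !inE => aS bS; apply/negP => eab.
have aU : a \in P :|: Q by rewrite inE; case: (f a) aS => ->; rewrite ?orbT.
have bU : b \in P :|: Q by rewrite inE; case: (f b) bS => ->; rewrite ?orbT.
move: (fPQ a b aU bU eab); case: (f a) aS; case: (f b) bS => // bS aS _.
  by move: (PQ a b aS bS); rewrite eab.
by move: (PQ b a bS aS); rewrite e_sym eab.
Qed.

Lemma card_color_swap f P Q :
  #|color_swap f P Q| + #|color_swap (predC f) P Q| = #|P| + #|Q|.
Proof.
have EU : color_swap f P Q :|: color_swap (predC f) P Q = P :|: Q.
  by apply/setP => x; rewrite !inE /=; case: (f x); rewrite // orbC.
have EI : color_swap f P Q :&: color_swap (predC f) P Q = P :&: Q.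
  by apply/setP => x; rewrite !inE /=; case: (f x); rewrite // andbC.
by rewrite -cardsUI EU EI cardsUI.
Qed.

Lemma bipartite_nonadjacent_leq e f P Q : symmetric e -> nonadjacent e P Q ->
    {in P :|: Q &, forall a b, e a b -> f a != f b} ->
  #|P| + #|Q| <= alpha e + alpha e.
Proof.
move=> e_sym PQ fPQ; rewrite -(card_color_swap f).
apply: leq_add; apply: leq_alpha; apply: color_swap_nonadjacent => //.
by move=> a b aU bU /(fPQ a b aU bU); rewrite /=; case: (f a); case: (f b).
Qed.

(** * Critical edges and König's theorem *)

Lemma critical_edge_mem e x y J : symmetric e ->
    nonadjacent (remove_edge e x y) J J -> alpha e < #|J| ->
  (x \in J) && (y \in J).
Proof.
move=> e_sym /nonadjacentP iJ; apply: contraLR => xyJ; rewrite -leqNgt.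
apply/leq_alpha/nonadjacentP => a b aJ bJ; apply/negP => eab.
case: (remove_edgeP x y eab) => [eab'|[? ?]|[? ?]]; subst.
- by move: (iJ a b aJ bJ); rewrite eab'.
- by move: xyJ; rewrite aJ bJ.
- by move: xyJ; rewrite aJ bJ.
Qed.

Lemma critical_path_pair e x y z : symmetric e -> irreflexive e ->
    e x y -> e y z -> x != z ->
    alpha e < alpha (remove_edge e x y) ->
    alpha e < alpha (remove_edge e y z) ->
  exists P Q, nonadjacent e P Q /\ (alpha e).*2 < #|P| + #|Q|.
Proof.
move=> e_sym e_irr exy eyz xz.
have [I iI <-] := alpha_attained (remove_edge e x y) => cI.
have [J iJ <-] := alpha_attained (remove_edge e y z) => cJ.
have /andP[xI yI] := critical_edge_mem e_sym iI cI.
have /andP[yJ zJ] := critical_edge_mem e_sym iJ cJ.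
have yNx : (y == x) = false by apply/eqP => E; rewrite E e_irr in exy.
have yNz : (y == z) = false by apply/eqP => E; rewrite E e_irr in eyz.
move/nonadjacentP: iI => iI; move/nonadjacentP: iJ => iJ.
(* Otherwise [J] would contain both ends of [xy], an edge that survives the deletion of [yz]. *)
have xJ : x \notin J.
  apply/negP => xJ; case: (remove_edgeP y z exy) => [e'|[E _]|[E _]].
  - by move: (iJ x y xJ yJ); rewrite e'.
  - by rewrite E eqxx in yNx.
  - by rewrite E eqxx in xz.
have zI : z \notin I.
  apply/negP => zI; case: (remove_edgeP x y eyz) => [e'|[E _]|[_ E]].
  - by move: (iI y z yI zI); rewrite e'.
  - by rewrite E eqxx in yNx.
  - by rewrite E eqxx in xz.
exists ((I :&: J) :\ y), (I :|: J); split.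
  apply/nonadjacentP => a b; rewrite !inE => /and3P[ay aI aJ] bIJ.
  apply/negP => eab; case/orP: bIJ => [bI|bJ].
    case: (remove_edgeP x y eab) => [e'|[E _]|[E _]].
    - by move: (iI a b aI bI); rewrite e'.
    - by rewrite -E aJ in xJ.
    - by rewrite E eqxx in ay.
  case: (remove_edgeP y z eab) => [e'|[E _]|[E _]].
  - by move: (iJ a b aJ bJ); rewrite e'.
  - by rewrite E eqxx in ay.
  - by rewrite -E aI in zI.
(* Dropping [y] leaves weight [#|I| + #|J| - 1], which is at least [2 * alpha e + 1]. *)
have yIJ : y \in I :&: J by rewrite inE yI.
have := cardsUI I J; rewrite (cardsD1 y (I :&: J)) yIJ.
by move: cI cJ; clear; lia.
Qed.

Lemma konig_bipartite e f : symmetric e -> irreflexive e -> bipartition e f ->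
  #|T| <= alpha e + mu e.
Proof.
have [n] := ubnP (arc_count e); elim: n e => // n IH e; rewrite ltnS => en.
move=> e_sym e_irr fe; case: leqP => // ke.
have critical x y : e x y -> alpha e < alpha (remove_edge e x y).
  move=> exy; rewrite -(ltn_add2r (mu e)); apply: (leq_trans ke).
  apply: (@leq_trans (alpha (remove_edge e x y) + mu (remove_edge e x y))).
    apply: IH; [|exact: remove_edge_sym|exact: remove_edge_irr|].
      exact: leq_trans (arc_count_remove exy) en.
    by move=> a b /remove_edge_sub; apply: fe.
  by rewrite leq_add2l; apply/leq_mu_sub/remove_edge_sub.
have deg1 x y z : e x y -> e y z -> x = z.
  move=> exy eyz; apply/eqP/negPn/negP => xz.
  have [P [Q [PQ]]] := critical_path_pair e_sym e_irr exy eyz xz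
    (critical _ _ exy) (critical _ _ eyz).
  rewrite ltnNge -addnn (bipartite_nonadjacent_leq (f := f)) //.
  by move=> a b _ _; apply: fe.
(* The edges are now pairwise disjoint. [D] takes the end coloured [true] of each: its complement is
   independent, and the edges at [D] form a matching. The default value of [g] is never reached on
   [D]. *)
pose D := [set x | f x && [exists y, e x y]].
pose g x := odflt x [pick y | e x y].
have eg x : x \in D -> e x (g x).
  rewrite inE /g => /andP[_ /existsP[y exy]].
  by case: pickP => //= /(_ y); rewrite exy.
have fD x : x \in D -> f x by rewrite inE => /andP[].
have fg x : x \in D -> f (g x) = false.
  by move=> xD; have := fe _ _ (eg x xD); rewrite (fD x xD); case: (f _).
have inj x x' w : x \in D -> x' \in D ->
    w \in [set x; g x] -> w \in [set x'; g x'] -> x = x'.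
  move=> xD x'D /set2P[]-> /set2P[] // E.
  - by have := fg _ x'D; rewrite -E fD.
  - by have := fg _ xD; rewrite E fD.
  - apply: (@deg1 x (g x)); first exact: eg.
    by rewrite E e_sym; apply: eg.
suff: #|~: D| + #|D| <= alpha e + mu e by rewrite addnC cardsC leqNgt ke.
apply: leq_add.
  apply/leq_alpha/nonadjacentP => a b; rewrite !inE !negb_and => aD bD.
  apply/negP => eab; have := fe _ _ eab.
  case/orP: aD => [/negbTE->|/existsP[]]; last by exists b.
  case/orP: bD => [/negbTE->//|/existsP[]]; by exists a; rewrite e_sym.
have <- : #|[set [set x; g x] | x in D]| = #|D|.
  apply: card_in_imset => x x' xD x'D E.
  by apply: (@inj x x' x) => //; rewrite -?E set21.
apply/leq_mu/andP; split.
  apply/subsetP => A /imsetP[x xD ->]; apply/edgesP.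
  by exists x, (g x); split=> //; apply: eg.
apply/trivIsetP => A B /imsetP[x xD ->] /imsetP[x' x'D ->]; apply: contraNT.
case/pred0Pn => w /andP[/= wx wx']; by rewrite (@inj x x' w).
Qed.

(** * Odd cycles and bipartitions *)

Lemma bipartition_parity e f x p : bipartition e f -> path e x p ->
  f (last x p) = f x (+) odd (size p).
Proof.
move=> fe; elim: p x => [|y p IH] x /=; first by rewrite addbF.
case/andP=> exy /IH ->; move: (fe _ _ exy).
by case: (f x); case: (f y); case: (odd _).
Qed.

(** Delete an edge [xy] and colour the rest by induction. If [x] and [y] get the same colour, a
    remaining path between them would close up to an odd cycle; so they are disconnected, and the
    colours on the component of [y] can be flipped. *)
Lemma no_odd_cycle_bipartition e : symmetric e -> irreflexive e ->
    (forall C, ~ odd_cycle e C) ->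
  exists f, bipartition e f.
Proof.
have [n] := ubnP (arc_count e); elim: n e => // n IH e; rewrite ltnS => en.
move=> e_sym e_irr no_odd.
have [[x y] /= exy | e0] := pickP [pred p : T * T | e p.1 p.2]; last first.
  by exists xpredT => a b eab; have := e0 (a, b); rewrite /= eab.
have e'_sym := remove_edge_sym x y e_sym.
have [||f fe'] := IH (remove_edge e x y) _ e'_sym (remove_edge_irr x y e_irr).
- exact: leq_trans (arc_count_remove exy) en.
- move=> C [c [cc uc sc oc EC]]; apply: (no_odd (cycle_edges c)).
  exists c; split=> //.
  exact: sub_cycle (@remove_edge_sub _ _ _) _ cc.
have [fxy | fxy] := eqVneq (f x) (f y); last first.
  exists f => a b eab.
  by case: (remove_edgeP x y eab) => [/fe'|[-> ->]|[-> ->]] //; rewrite eq_sym.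
have [/connectP[p yp] | Nyx] := boolP (connect (remove_edge e x y) y x).
  case/shortenP: yp => q yq uq _ xq.
  have par := bipartition_parity fe' yq.
  have size_q : ~~ odd (size q).
    by move: par; rewrite -xq fxy; case: (f y); case: odd.
  case: (no_odd (cycle_edges (y :: q))); exists (y :: q); split => //.
  - rewrite /= rcons_path -xq exy andbT.
    exact: sub_path (@remove_edge_sub _ _ _) _ _ yq.
  - case: (q) size_q xq => [|a [|b r]] //= _ E.
    by rewrite E e_irr in exy.
exists (fun v => f v (+) connect (remove_edge e x y) y v) => a b eab.
case: (remove_edgeP x y eab) => [e'ab|[-> ->]|[-> ->]].
- rewrite (same_connect1r (sym_connect_sym e'_sym) e'ab).
  by have := fe' _ _ e'ab; case: (f a); case: (f b); case: connect.
- by rewrite fxy connect0 (negbTE Nyx); case: (f y).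
- by rewrite fxy connect0 (negbTE Nyx); case: (f y).
Qed.

Lemma cycle_edge_mem (c : seq T) x :
  x \in c -> [set x; next c x] \in cycle_edges c.
Proof. by move=> xc; apply/imsetP; exists x. Qed.

(** A surviving odd cycle would have the edge set of [c], which contains the deleted edge. *)
Lemma bipartition_remove_cycle_edge e c x : symmetric e -> irreflexive e ->
    (forall C, odd_cycle e C -> C = cycle_edges c) -> x \in c ->
  exists f, bipartition (remove_edge e x (next c x)) f.
Proof.
move=> e_sym e_irr c_unique xc; apply: no_odd_cycle_bipartition.
- exact: remove_edge_sym.
- exact: remove_edge_irr.
move=> C [c' [cc' uc' sc' oc' EC]].
have Ec : cycle_edges c' = cycle_edges c.
  apply: c_unique; exists c'; split=> //.
  exact: sub_cycle (@remove_edge_sub _ _ _) _ cc'.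
have := cycle_edge_mem xc; rewrite -Ec => /imsetP[a ac' E].
by have := next_cycle cc' ac'; rewrite /remove_edge E eqxx andbF.
Qed.

Lemma next_next_neq (c : seq T) x : uniq c -> 2 < size c -> x \in c ->
  x != next c (next c x).
Proof.
move=> uc sc xc; have [i s Es] := rot_to xc.
have us : uniq (x :: s) by rewrite -Es rot_uniq.
have ss : 2 < size (x :: s) by rewrite -Es size_rot.
rewrite -!(next_rot i uc) Es; case: s {Es} us ss => [|a [|b r]] //= us _.
move: us; rewrite !inE !negb_or => /andP[/and3P[xa xb _] _].
by rewrite eqxx (eq_sym a) (negbTE xa) eqxx.
Qed.

(** * Exchange operations on pairs *)

Lemma nonadjacentU e P1 P2 Q1 Q2 : nonadjacent e P1 Q1 -> nonadjacent e P2 Q2 ->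
  nonadjacent e (P1 :|: P2) (Q1 :&: Q2).
Proof.
move=> /nonadjacentP H1 /nonadjacentP H2; apply/nonadjacentP => a b.
by rewrite !inE => /orP[aP|aP] /andP[b1 b2]; [apply: H1 | apply: H2].
Qed.

Lemma nonadjacent_sym e P Q : symmetric e ->
  nonadjacent e P Q -> nonadjacent e Q P.
Proof.
move=> e_sym /nonadjacentP H; apply/nonadjacentP => a b aQ bP.
by rewrite e_sym; apply: H.
Qed.

Lemma nonadjacent_corona_core e : nonadjacent e (corona e) (core e).
Proof.
apply/nonadjacentP => a b /bigcupP[S mS aS] /bigcapP/(_ S mS) bS.
by move: mS; rewrite max_independentE => /andP[/nonadjacentP iS _]; apply: iS.
Qed.

Lemma independentU_nonadjacent e P Q S : symmetric e ->
    nonadjacent e P Q -> Q \subset P -> nonadjacent e S S ->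
  nonadjacent e ((S :&: P) :|: Q) ((S :&: P) :|: Q).
Proof.
move=> e_sym /nonadjacentP PQ /subsetP QP /nonadjacentP iS.
apply/nonadjacentP => a b; rewrite !inE.
case/orP=> [/andP[aS aP]|aQ] /orP[/andP[bS bP]|bQ].
- exact: iS.
- exact: PQ.
- by rewrite e_sym; apply: PQ.
- by apply: PQ => //; apply: QP.
Qed.

End Graph.

(** * A heavy pair with largest first set, compared with corona and core *)

Theorem theorem2p17 (T : finType) (e : rel T)
    (e_sym : symmetric e) (e_irr : irreflexive e)
    (G_ab : almost_bipartite e) (G_nke : ~ konig_egervary e) :
  #|corona e| + #|core e| = 2 * alpha e + 1.
Proof.
have [_ [[c [cc uc sc oc ->]] /(_ _ _)/esym c_unique]] := G_ab.
have lt_ke : alpha e + mu e < #|T|.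
  by rewrite ltn_neqAle alpha_mu_leq andbT; apply/eqP.
have bip v : v \in c -> exists f, bipartition (remove_edge e v (next c v)) f.
  exact: bipartition_remove_cycle_edge.
have enext v : v \in c -> e v (next c v) by apply: next_cycle.
have critical v : v \in c -> alpha e < alpha (remove_edge e v (next c v)).
  move=> vc; have [f fb] := bip v vc; rewrite -(ltn_add2r (mu e)).
  apply: (leq_trans lt_ke).
  apply: leq_trans (konig_bipartite (remove_edge_sym _ _ e_sym)
    (remove_edge_irr _ _ e_irr) fb) _.
  by rewrite leq_add2l; apply/leq_mu_sub/remove_edge_sub.
(* A set avoiding [v] does not see the deleted edge, so the colouring is proper there for [e]
   itself. *)
have swap_bip v P Q : v \in c -> v \notin P :|: Q ->
    exists f : T -> bool, {in P :|: Q &, forall a b, e a b -> f a != f b}.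
  move=> vc vPQ; have [f fb] := bip v vc; exists f => a b aU bU eab.
  case: (remove_edgeP v (next c v) eab) => [/fb //|[E _]|[_ E]].
  - by rewrite -E aU in vPQ.
  - by rewrite -E bU in vPQ.
have nonadjD1 v P Q : nonadjacent e P Q -> nonadjacent e (P :\ v) (Q :\ v).
  move/nonadjacentP=> PQ; apply/nonadjacentP => a b /setD1P[_ aP] /setD1P[_ bQ].
  exact: PQ.
have weight_leq v P Q : v \in c -> nonadjacent e P Q ->
    #|P| + #|Q| <= (alpha e).*2 + (v \in P) + (v \in Q).
  move=> vc PQ; have [|f fb] := swap_bip v (P :\ v) (Q :\ v) vc.
    by rewrite !inE eqxx.
  have := bipartite_nonadjacent_leq e_sym (nonadjD1 v _ _ PQ) fb.
  by rewrite (cardsD1 v P) (cardsD1 v Q); clear; lia.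
have [x xc] : exists x, x \in c.
  by case: (c) sc => // a r _; exists a; rewrite mem_head.
have nc v : v \in c -> next c v \in c by rewrite mem_next.
set y := next c x; have yc : y \in c by apply: nc.
have yx : y != x.
  by apply/eqP => E; have := enext x xc; rewrite -/y E e_irr.
have weight_leq1 P Q : nonadjacent e P Q -> #|P| + #|Q| <= (alpha e).*2.+1.
  move=> PQ; rewrite leqNgt; apply/negP => big.
  (* A larger weight would force both [x] and [y] into [P] and into [Q], although they are
     adjacent. *)
  have := weight_leq x P Q xc PQ; have := weight_leq y P Q yc PQ.
  have [xP | _] := boolP (x \in P); have [yQ | _] := boolP (y \in Q);
    try by move: big; clear; lia.
  by move/nonadjacentP: PQ => /(_ _ _ xP yQ); rewrite enext.
have [P0 [Q0 PQ0]] : exists P Q, nonadjacent e P Q /\ (alpha e).*2 < #|P| + #|Q|.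
  apply: (critical_path_pair (x := x) (y := y) (z := next c y)) => //.
  - exact: enext.
  - exact: enext.
  - exact: next_next_neq.
  - exact: critical.
  - exact: critical.
pose good (X : {set T} * {set T}) :=
  nonadjacent e X.1 X.2 && ((alpha e).*2 < #|X.1| + #|X.2|).
have good0 : good (P0, Q0) by apply/andP.
case: (arg_maxnP (fun X : {set T} * {set T} => #|X.1|) good0) => -[P Q] /=.
move=> /andP[/= PQ big] Pmax.
have QP : Q \subset P.
  (* This is a pair of the same weight, so maximality forbids its first set to exceed [P]. *)
  have := Pmax (P :|: Q, P :&: Q); rewrite /good /= cardsUI big andbT setIC.
  rewrite (nonadjacentU PQ (nonadjacent_sym e_sym PQ)) => /(_ isT) le.
  suff /eqP -> : P == P :|: Q by apply: subsetUr.
  by rewrite eqEcard subsetUl.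
have c_sub v : v \in c -> v \in P.
  move=> vc; have := weight_leq v P Q vc PQ.
  case: (boolP (v \in P)) => // vP; rewrite (contraNF (subsetP QP v) vP) !addn0.
  by rewrite leqNgt big.
have cQ v : v \in c -> v \notin Q.
  move=> vc; apply/negP => vQ.
  move/nonadjacentP: PQ => /(_ _ _ (c_sub _ (nc v vc)) vQ).
  by rewrite e_sym enext.
(* Dropping [v] costs exactly 1, so weight at least [2 * alpha e] remains. Both colour halves are
   therefore maximum independent sets, and each vertex of [P :\ v] lies in one of them. *)
have sub_corona v : v \in c -> P :\ v \subset corona e.
  move=> vc; have [|f fb] := swap_bip v (P :\ v) (Q :\ v) vc.
    by rewrite !inE eqxx.
  have fb' : {in P :\ v :|: Q :\ v &,
      forall a b, e a b -> predC f a != predC f b}.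
    by move=> a b aU bU /(fb a b aU bU); rewrite /=; case: (f a); case: (f b).
  have i1 := color_swap_nonadjacent e_sym (nonadjD1 v _ _ PQ) fb.
  have i2 := color_swap_nonadjacent e_sym (nonadjD1 v _ _ PQ) fb'.
  have l1 := leq_alpha i1; have l2 := leq_alpha i2.
  have sum := card_color_swap f (P :\ v) (Q :\ v).
  move: big; rewrite (cardsD1 v P) (cardsD1 v Q) c_sub // (negbTE (cQ v vc)) => big.
  apply/subsetP => a aP; apply/bigcupP; have [fa | fa] := boolP (f a).
    exists (color_swap f (P :\ v) (Q :\ v)); last by rewrite inE fa.
    by rewrite max_independentE i1; move: big l1 l2 sum; clear; lia.
  exists (color_swap (predC f) (P :\ v) (Q :\ v)); last by rewrite inE /= fa.
  by rewrite max_independentE i2; move: big l1 l2 sum; clear; lia.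
have P_corona : P \subset corona e.
  apply/subsetP => a aP; have [E | ax] := eqVneq a x.
    by apply: (subsetP (sub_corona y yc)); rewrite !inE aP E eq_sym yx.
  by apply: (subsetP (sub_corona x xc)); rewrite !inE aP ax.
have Q_core : Q \subset core e.
  apply/bigcapsP => S; rewrite max_independentE => /andP[iS leS].
  (* The bound [#|S :&: P| + #|Q| - #|S :&: Q| <= #|S|] shows that [(S :|: P, S :&: Q)] weighs at
     least as much as [(P, Q)]. Maximality then gives [S \subset P], and the same bound becomes
     [#|Q| <= #|S :&: Q|]. *)
  have := leq_alpha (independentU_nonadjacent e_sym PQ QP iS).
  have := Pmax (S :|: P, S :&: Q); rewrite /good /= nonadjacentU //=.
  have := cardsUI (S :&: P) Q; rewrite -setIA (setIidPr QP).
  have := cardsUI S P => ESP ESPQ Pmax_S le_alpha.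
  have leP : #|S :|: P| <= #|P|.
    by apply: Pmax_S; move: big leS ESP ESPQ le_alpha; clear; lia.
  suff /eqP <- : S :&: Q == Q by apply: subsetIl.
  by rewrite eqEcard subsetIr; move: leS ESP ESPQ le_alpha leP; clear; lia.
have := subset_leq_card P_corona; have := subset_leq_card Q_core.
have := weight_leq1 _ _ (nonadjacent_corona_core e).
by move: big; clear; lia.
Qed.
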